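(* Let $p$ be a prime, $l\ge1$, and let $s_1,\ldots,s_l$ be positive integers. Put $w=\sum_{i=1}^l s_i$ and $I=\{s_1,\,s_1+s_2,\,\dots,\,s_1+s_2+\dots+s_{l-1}\}$ (so $I=\emptyset$ if $l=1$). Then $$H_{p-1}^q(s_1,\ldots,s_l)\equiv (-1)^l\sum_{\substack{1\leq j_1\leq j_2\leq\dots\leq j_w\leq p-1\\ j_i<j_{i+1},\; i\in I}}\ \prod_{i=1}^w\frac{q^{j_i}}{[j_i]_q} \pmod{[p]_q}.$$
   Context: Here $q$ is an indeterminate and $[n]_q=\frac{1-q^n}{1-q}=1+q+\cdots+q^{n-1}$. For positive integers $s_1,\dots,s_l$, $$H_n^q(s_1,\ldots,s_l)=\sum_{1\le k_1<\cdots<k_l\le n}\prod_{i=1}^l\frac{q^{(s_i-1)k_i}}{[k_i]_q^{s_i}}$$ (which is $0$ if $n<l$). In the sum over $j_1,\dots,j_w$ the inequality $j_i\le j_{i+1}$ is required for all $1\le i\le w-1$, and it is required to be strict for $i\in I$. For a prime $p$ and rational functions $A,B$ in $q$, $A\equiv B\pmod{[p]_q}$ means $A-B=f/g$ with $f,g$ polynomials in $q$ with integer coefficients, $g$ coprime to $[p]_q$ in $\mathbb{Q}[q]$, and $[p]_q\mid f$ ($[p]_q$ is the $p$th cyclotomic polynomial, irreducible over $\mathbb{Q}$). *)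

(* Defs.v *)
From HB Require Import structures.
From mathcomp Require Import all_boot all_order all_algebra.
Set Implicit Arguments.
Unset Strict Implicit.
Unset Printing Implicit Defensive.
Import Order.TTheory GRing.Theory Num.Theory.
Local Open Scope ring_scope.

Definition ratfun : fieldType := {fraction {poly rat}}.

Definition ratpoly (f : {poly int}) : {poly rat} := map_poly intr f.

Definition polyfun (f : {poly int}) : ratfun := tofrac (ratpoly f).

Definition q : ratfun := polyfun 'X.

Definition qnum_poly (n : nat) : {poly int} := \sum_(i < n) 'X^i.

Definition qnum (n : nat) : ratfun := polyfun (qnum_poly n).

Lemma qnumE (n : nat) : qnum n = (1 - q ^+ n) / (1 - q).
Proof.
have polyfunB f g : polyfun (f - g) = polyfun f - polyfun g.
  by rewrite /polyfun /ratpoly !rmorphB.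
have polyfunM f g : polyfun (f * g) = polyfun f * polyfun g.
  by rewrite /polyfun /ratpoly !rmorphM.
have polyfun1 : polyfun 1 = 1 by rewrite /polyfun /ratpoly !rmorph1.
have polyfunX m : polyfun ('X^m) = q ^+ m.
  by elim: m => [|m IH]; rewrite ?expr0 ?exprS ?polyfunM ?IH.
have q1 : 1 - q != 0.
  rewrite /q -polyfun1 -polyfunB /polyfun tofrac_eq0 /ratpoly rmorphB /=.
  by rewrite rmorph1 map_polyX subr_eq0 eq_sym -subr_eq0 polyXsubC_eq0.
apply: (canRL (mulfK q1)).
rewrite -polyfunX /q -polyfun1 -!polyfunB -polyfunM; congr polyfun.
by rewrite -opprB -[RHS]opprB subrX1 mulrN mulrC.
Qed.

(* Positions are numbered from 0: [s i], [k i] stand for s_{i+1}, k_{i+1}. *)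
Definition Hq (n l : nat) (s : 'I_l -> nat) : ratfun :=
  \sum_(k : {ffun 'I_l -> 'I_n.+1} |
          [forall i : 'I_l, (0 < k i)%N] &&
          [forall i : 'I_l, forall j : 'I_l, (i < j)%N ==> (k i < k j)%N])
    \prod_(i < l) (q ^+ ((s i - 1) * k i)%N / qnum (k i) ^+ s i).

Definition psums (l : nat) (s : 'I_l -> nat) : seq nat :=
  [seq (\sum_(i < l | (i < m)%N) s i)%N | m <- iota 1 l.-1].

(* The elements of [I] are numbered from 1, as in the sum over j_1, ..., j_w,
   while [j a] stands for j_{a+1}: the inequality between [j a] and [j a.+1]
   is strict when [a.+1] is in [I]. *)
Definition Sq (n w : nat) (I : seq nat) : ratfun :=
  \sum_(j : {ffun 'I_w -> 'I_n.+1} |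
          [forall a : 'I_w, (0 < j a)%N] &&
          [forall a : 'I_w, forall b : 'I_w, (b == a.+1 :> nat) ==>
             (if a.+1 \in I then (j a < j b)%N else (j a <= j b)%N)])
    \prod_(a < w) (q ^+ j a / qnum (j a)).

(* Divisibility of the numerator is in Z[q], coprimality in Q[q]. *)
Definition eqmod_qnum (p : nat) (A B : ratfun) : Prop :=
  exists f g : {poly int},
    [/\ A - B = polyfun f / polyfun g,
        coprimep (ratpoly g) (ratpoly (qnum_poly p)) &
        exists h : {poly int}, f = h * qnum_poly p].

(* Main.v *)
(* With b_n(k) = (-1)^k q^(k(k+1)/2) [n choose k]_q, the identity
     (-1)^l sum over 1 <= k_1 < ... < k_l <= n of
       b_n(k_l) prod_i q^((s_i - 1) k_i) / [k_i]^(s_i)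
     = sum over the j's of prod_i q^(j_i) / [j_i]
   holds for every n, exactly: seen as functions of the word of w letters and
   of n, both sides satisfy the same recursion, obtained from
     (b_(n+1)(k) - b_n(k)) q^k / [k] = q^(n+1) / [n+1] b_(n+1)(k)
   when the last letter repeats the index, and from this combined with the
   telescoping relation q^(-k) b_(n+1)(k) = b_n(k) - b_n(k-1) when it starts a
   new one. Modulo [p] one has
   b_(p-1)(k) = 1 for k < p, because [p] divides b_p(k) for 0 < k < p. *)
Require Import Defs.
From mathcomp Require Import all_boot all_order all_algebra.
From mathcomp Require Import ring zify.
Set Implicit Arguments.
Unset Strict Implicit.
Unset Printing Implicit Defensive.
Import GRing.Theory Num.Theory.
Local Open Scope ring_scope.

(** * q-integers and signed q-binomial coefficients *)

Definition qint (K : fieldType) (x : K) (n : nat) : K := \sum_(i < n) x ^+ i.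

Lemma qint0 (K : fieldType) (x : K) : qint x 0 = 0.
Proof. by rewrite /qint big_ord0. Qed.

Lemma qintS (K : fieldType) (x : K) n : qint x n.+1 = 1 + x * qint x n.
Proof.
rewrite /qint big_ord_recl expr0 mulr_sumr; congr (_ + _).
by apply: eq_bigr => i _; rewrite exprS.
Qed.

Lemma qint_geom (K : fieldType) (x : K) n : x ^+ n = 1 + (x - 1) * qint x n.
Proof. by rewrite -subrX1 addrC subrK. Qed.

(* [sgbin x n k] is (-1)^k x^(k(k+1)/2) times the q-binomial coefficient of
   n and k. *)
Fixpoint sgbin (K : fieldType) (x : K) (n k : nat) : K :=
  match n, k with
  | _, 0 => 1
  | 0, _.+1 => 0
  | n'.+1, k'.+1 => x ^+ k'.+1 * (sgbin x n' k'.+1 - sgbin x n' k')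
  end.

Lemma sgbin_n0 (K : fieldType) (x : K) n : sgbin x n 0 = 1.
Proof. by case: n. Qed.

Lemma sgbinSS (K : fieldType) (x : K) n k :
  sgbin x n.+1 k.+1 = x ^+ k.+1 * (sgbin x n k.+1 - sgbin x n k).
Proof. by []. Qed.

Lemma sgbin_small (K : fieldType) (x : K) n k : (n < k)%N -> sgbin x n k = 0.
Proof.
elim: n k => [|n IHn] [|k] //; rewrite ltnS => lt_nk.
by rewrite sgbinSS !IHn ?subrr ?mulr0 // ltnW.
Qed.

(** The absorption identity: for k <= n the bracket equals -x^(k+1) [n-k], written so as to avoid
    subtraction in [nat]. *)
Lemma sgbin_absorb (K : fieldType) (x : K) n k :
  qint x k.+1 * sgbin x n k.+1 =
  (x ^+ n.+1 * qint x k.+1 - x ^+ k.+1 * qint x n.+1) * sgbin x n k.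
Proof.
elim: n k => [|n IHn] [|k] /=.
- by rewrite subrr mulr0 mul0r.
- by rewrite !mulr0.
- have := IHn 0; rewrite !sgbin_n0 !qintS qint0 mulr0 addr0 => H.
  rewrite mul1r mulr1 in H; rewrite H !exprS expr0.
  by ring.
have Ek := IHn k; have Ek1 := IHn k.+1.
have gk := qint_geom x k.+1; have gn := qint_geom x n.+1.
move: Ek Ek1; rewrite !(qintS _ k.+1) !(qintS _ n.+1).
rewrite (exprS _ k.+1) (exprS _ n.+1).
set a := sgbin x n k; set b := sgbin x n k.+1; set c := sgbin x n k.+2.
move: gk gn; set u := qint x k.+1; set v := qint x n.+1.
move: (x ^+ k.+1) (x ^+ n.+1) => X N -> -> Ek Ek1.
set y := x - 1 in Ek Ek1 *.
have -> : (1 + x * u) * (x * (1 + y * u) * (c - b)) =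
  x * (1 + y * u) * ((1 + x * u) * c - (1 + x * u) * b) by ring.
rewrite Ek1.
have xE : x = 1 + y by rewrite /y; ring.
move: Ek => /eqP; rewrite -subr_eq0 => /eqP Ek.
apply/eqP; rewrite -subr_eq0; apply/eqP.
(* Once [Ek1] has removed [c], what remains is this multiple of the identity at [k]; the powers
   x^(k+1) and x^(n+1) have become 1 + y u and 1 + y v. *)
transitivity (- x * (1 + y * u) *
  (u * b - ((1 + y * v) * u - (1 + y * u) * v) * a)); last by rewrite Ek mulr0.
by rewrite xE; ring.
Qed.

Lemma sgbin_diff (K : fieldType) (x : K) n k :
  qint x n.+1 * (sgbin x n.+1 k - sgbin x n k) * x ^+ k =
  x ^+ n.+1 * qint x k * sgbin x n.+1 k.
Proof.
case: k => [|k]; first by rewrite !sgbin_n0 subrr qint0 !mulr0 !mul0r.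
have E := sgbin_absorb x n k; rewrite sgbinSS.
have gk := qint_geom x k.+1; have gn := qint_geom x n.+1.
move: E; set a := sgbin x n k; set b := sgbin x n k.+1.
move: gk gn; set u := qint x k.+1; set v := qint x n.+1.
move: (x ^+ k.+1) (x ^+ n.+1) => X N -> ->.
set y := x - 1.
move=> /eqP; rewrite -subr_eq0 => /eqP E.
apply/eqP; rewrite -subr_eq0; apply/eqP.
transitivity (- (1 + y * u) *
  (u * b - ((1 + y * v) * u - (1 + y * u) * v) * a)); last by rewrite E mulr0.
by ring.
Qed.

(** By the recursion the left side is x^(-k-1) [sgbin x n.+1 k.+1], and [sgbin_diff] brings out a
    factor [n+1]. For n + 1 = p this is the divisibility by [p]; the remaining denominators are a
    power of x and [k+1]. *)
Lemma sgbin_step (K : fieldType) (x : K) n k : x != 0 -> qint x k.+1 != 0 ->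
  sgbin x n k.+1 - sgbin x n k =
  x ^- n.+1 / qint x k.+1 * (sgbin x n.+1 k.+1 - sgbin x n k.+1) * qint x n.+1.
Proof.
move=> x0 k0; have E := sgbin_diff x n k.+1.
have xX m : x ^+ m != 0 by rewrite expf_neq0.
have -> : sgbin x n k.+1 - sgbin x n k = x ^- k.+1 * sgbin x n.+1 k.+1.
  by rewrite sgbinSS mulKf.
have xkK := mulfV (xX k.+1).
rewrite -[_ - _ in RHS]mulr1 -xkK.
rewrite [RHS](_ : _ = x ^- n.+1 / qint x k.+1 * x ^- k.+1 *
  (qint x n.+1 * (sgbin x n.+1 k.+1 - sgbin x n k.+1) * x ^+ k.+1)).
  by rewrite E; field; rewrite k0 !xX.
by ring.
Qed.

(** * Nested sums as sums over index tuples *)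

Fixpoint chain (K : fieldType) (r : nat -> bool) (u : nat -> nat -> K)
    (w n : nat) : K :=
  if w is w'.+1 then
    \sum_(1 <= m < n.+1) u w' m * chain r u w' (if r w' then m.-1 else m)
  else 1.

(** The bound [n] sits on the last index alone, apart from the fixed range [N], so that an induction
    on [w] can vary it; [r b] governs the comparison of letter [b] with the one before. *)
Definition chain_cond (N w n : nat) (r : nat -> bool)
    (j : {ffun 'I_w -> 'I_N.+1}) : bool :=
  [&& [forall a, (0 < j a)%N],
      [forall a : 'I_w, forall b : 'I_w, (b == a.+1 :> nat) ==>
         (if r b then (j a < j b)%N else (j a <= j b)%N)]
    & [forall a : 'I_w, (a.+1 == w) ==> (j a <= n)%N]].

Definition ffun_rcons (T : finType) (w : nat) (mj : T * {ffun 'I_w -> T}) :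
    {ffun 'I_w.+1 -> T} :=
  [ffun i => if unlift ord_max i is Some i' then mj.2 i' else mj.1].

Lemma ffun_rcons_lift (T : finType) (w : nat) (mj : T * {ffun 'I_w -> T}) i :
  ffun_rcons mj (lift ord_max i) = mj.2 i.
Proof. by rewrite ffunE liftK. Qed.

Lemma ffun_rcons_max (T : finType) (w : nat) (mj : T * {ffun 'I_w -> T}) :
  ffun_rcons mj ord_max = mj.1.
Proof. by rewrite ffunE unlift_none. Qed.

Lemma ffun_rcons_bij (T : finType) (w : nat) : bijective (@ffun_rcons T w).
Proof.
exists (fun j : {ffun 'I_w.+1 -> T} =>
          (j ord_max, [ffun i => j (lift ord_max i)])) => [[m j]|j].
- congr pair; first exact: ffun_rcons_max.
  by apply/ffunP => i; rewrite ffunE ffun_rcons_lift.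
- apply/ffunP => i; case: (unliftP ord_max i) => [i' ->|->].
    by rewrite ffun_rcons_lift ffunE.
  by rewrite ffun_rcons_max.
Qed.

(** The new last index enters only through its own bounds and the comparison with its predecessor,
    and that comparison is exactly the upper bound required of the shorter tuple. *)
Lemma chain_cond_rcons (N w n : nat) r (j : {ffun 'I_w -> 'I_N.+1}) m :
  chain_cond n r (ffun_rcons (m, j)) =
  (0 < m <= n)%N && chain_cond (if r w then m.-1 else m) r j.
Proof.
apply/and3P/andP => [[/forallP pos /forallP ord /forallP bnd]|].
- have m_gt0 : (0 < m)%N by have := pos ord_max; rewrite ffun_rcons_max.
  split.
    by have := bnd ord_max; rewrite ffun_rcons_max /= eqxx m_gt0.
  apply/and3P; split; apply/forallP => a.
  + by have := pos (lift ord_max a); rewrite ffun_rcons_lift.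
  + apply/forallP => b; have /forallP/(_ (lift ord_max b)) := ord (lift ord_max a).
    by rewrite !ffun_rcons_lift !lift_max.
  + apply/implyP => /eqP aw; have /forallP/(_ ord_max) := ord (lift ord_max a).
    rewrite ffun_rcons_lift ffun_rcons_max lift_max /= aw eqxx /=.
    by case: (r w) => // lt_jm; rewrite -ltnS prednK.
- case=> /andP[m_gt0 le_mn] /and3P[/forallP pos /forallP ord /forallP bnd].
  split; apply/forallP => a.
  + by case: (unliftP ord_max a) => [a' ->|->];
       rewrite ?ffun_rcons_lift ?ffun_rcons_max.
  + apply/forallP => b; apply/implyP => /eqP ba.
    have [a' Ea|Ea] := unliftP ord_max a; last first.
      by have := ltn_ord b; rewrite ba Ea ltnn.
    have [b' Eb|Eb] := unliftP ord_max b.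
      have /forallP/(_ b')/implyP := ord a'; rewrite Ea Eb !ffun_rcons_lift.
      rewrite lift_max => -> //; apply/eqP.
      by have := ba; rewrite Ea Eb !lift_max.
    move: ba; rewrite Ea Eb lift_max /= => ba.
    have /implyP := bnd a'; rewrite ffun_rcons_lift ffun_rcons_max -ba eqxx.
    by case: (r w) => /(_ isT) // le_jm; rewrite -(prednK m_gt0).
  + have [a' ->|->] := unliftP ord_max a.
      by rewrite lift_max eqSS ltn_eqF.
    by rewrite ffun_rcons_max le_mn implybT.
Qed.

Lemma sum_chain_cond (K : fieldType) (N w n : nat) (r : nat -> bool)
    (u : nat -> nat -> K) : (n <= N)%N ->
  \sum_(j : {ffun 'I_w -> 'I_N.+1} | chain_cond n r j) \prod_(a < w) u a (j a)
  = chain r u w n.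
Proof.
elim: w n => [|w IHw] n le_nN /=.
  rewrite (big_pred1 [ffun i => ord0]) ?big_ord0 // => j /=.
  have -> : j = [ffun=> ord0] by apply/ffunP => -[].
  by rewrite eqxx; apply/and3P; split; apply/forallP => -[].
rewrite (reindex (@ffun_rcons _ w)) /=; last first.
  by apply: onW_bij; apply: ffun_rcons_bij.
pose F (m : nat) := u w m * chain r u w (if r w then m.-1 else m).
transitivity (\sum_(m < N.+1 | (0 < m <= n)%N) F m).
  rewrite [RHS](eq_bigr (fun m : 'I_N.+1 => \sum_(j : {ffun 'I_w -> 'I_N.+1} |
      chain_cond (if r w then m.-1 else m) r j)
      u w m * \prod_(a < w) u a (j a))); last first.
    move=> m /andP[_ le_mn]; rewrite -mulr_sumr IHw //.
    case: (r w); last exact: leq_trans le_mn le_nN.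
    exact: leq_trans (leq_pred _) (leq_trans le_mn le_nN).
  rewrite pair_big_dep /=; apply: eq_big => [[m j]|[m j] _] /=.
    exact: chain_cond_rcons.
  rewrite big_ord_recr /= ffun_rcons_max mulrC; congr (_ * _).
  apply: eq_bigr => i _; congr (u _ (nat_of_ord _)).
  rewrite -[RHS](ffun_rcons_lift (m, j)); congr (ffun_rcons _ _).
  exact/val_inj/esym/lift_max.
rewrite -(big_mkord (fun m => 0 < m <= n)%N F).
(* The index 0 and the indices above [n] fail the condition, which leaves the range from 1 to
   [n]. *)
rewrite (big_cat_nat (n := 1)) //= big_nat_cond big1 ?add0r; last by case.
rewrite (big_cat_nat (n := n.+1)) //= [X in _ + X]big_nat_cond.
rewrite [X in _ + X]big1 ?addr0; last first.
  by move=> m /andP[/andP[lt_nm _] /andP[_]]; rewrite leqNgt lt_nm.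
rewrite big_nat_cond [RHS]big_nat_cond; apply: eq_big => m; rewrite // ltnS.
by rewrite andbb andbT.
Qed.

(** * Summing blocks against signed q-binomial coefficients *)

(* [block x r w k] sums the products of the first [w] letters over the index
   patterns whose last index is [k]: letter [w'] starts a new index, with
   factor [- 1 / [k]], if [r w'] holds, and repeats the current index, with
   factor [x^k / [k]], otherwise. *)
Fixpoint block (K : fieldType) (x : K) (r : nat -> bool) (w k : nat) : K :=
  if w is w'.+1 then
    if r w' then - (\sum_(i < k) block x r w' i) / qint x k
    else x ^+ k / qint x k * block x r w' k
  else (k == 0)%:R.

(** As [qint x 0] is 0 and its inverse is 0 by convention, index 0 survives only for the empty word,
    where it marks the start. *)
Lemma block_index0 (K : fieldType) (x : K) r w :
  (0 < w)%N -> block x r w 0 = 0.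
Proof. by case: w => //= w _; rewrite qint0 invr0 !mulr0 mul0r if_same. Qed.

(** Summation by parts; the lower boundary term is an empty sum. *)
Lemma abel_sum (K : fieldType) (b a : nat -> K) n :
  \sum_(k < n) (b k.+1 - b k) * (\sum_(i < k.+1) a i) =
  b n * (\sum_(i < n) a i) - \sum_(k < n) b k * a k.
Proof.
elim: n => [|n IHn]; first by rewrite !big_ord0 mulr0 subrr.
by rewrite !(big_ord_recr n) IHn /=; ring.
Qed.

(** Outer induction on the word, inner induction on [n], comparing the increments of the two sides
    in [n]. Since [r 0] holds, a letter that repeats an index always has a letter before it. *)
Lemma sum_sgbin_block (K : fieldType) (x : K) (r : nat -> bool) w n :
  x != 0 -> (forall m, qint x m.+1 != 0) -> r 0 ->
  \sum_(k < n.+1) sgbin x n k * block x r w k =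
  chain r (fun _ m => x ^+ m / qint x m) w n.
Proof.
move=> x0 nz r0; elim: w n => [|w IHw] n.
  rewrite big_ord_recl /= sgbin_n0 mulr1 big1 ?addr0 // => i _.
  by rewrite mulr0.
elim: n => [|n IHn].
  by rewrite big_ord1 block_index0 // mulr0 /= big_geq.
rewrite [RHS]/= big_nat_recr //= -[X in X + _]/(chain _ _ w.+1 n) -{}IHn.
apply/eqP; rewrite addrC -subr_eq; apply/eqP.
(* The added term k = n + 1 is zero, and both sums now run over the same range. *)
rewrite [X in _ - X](_ : _ = \sum_(k < n.+2) sgbin x n k * block x r w.+1 k);
  last by rewrite [RHS]big_ord_recr /= sgbin_small // mul0r addr0.
rewrite -sumrB.
have xX k : x ^+ k != 0 by rewrite expf_neq0.
have diff k : (sgbin x n.+1 k - sgbin x n k) * x ^+ k =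
    x ^+ n.+1 / qint x n.+1 * (qint x k * sgbin x n.+1 k).
  apply: (mulfI (nz n)); rewrite [LHS]mulrA sgbin_diff.
  by field.
under eq_bigr do rewrite -mulrBl.
rewrite /=; case: ifP => rw; rewrite -IHw; last first.
  have w_gt0 : (0 < w)%N by case: w rw {IHw} => //; rewrite r0.
  rewrite mulr_sumr; apply: eq_bigr => k _; rewrite !mulrA diff.
  case: (nat_of_ord k) => [|k']; first by rewrite block_index0 // !mulr0.
  by field; rewrite !nz.
rewrite big_ord_recl !sgbin_n0 subrr mul0r add0r.
(* The weight x^(-k-1) b_(n+1)(k+1) is the difference b_n(k+1) - b_n(k), ready for summation by
   parts. *)
transitivity (x ^+ n.+1 / qint x n.+1 * - \sum_(k < n.+1)
    (sgbin x n k.+1 - sgbin x n k) * (\sum_(i < k.+1) block x r w i)).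
  rewrite -sumrN mulr_sumr; apply: eq_bigr => k _; rewrite lift0.
  have D := diff k.+1.
  apply: (mulIf (xX k.+1)).
  rewrite mulrAC D sgbinSS.
  by field; rewrite !nz.
(* The upper boundary term vanishes because b_n(n+1) = 0. *)
by rewrite abel_sum sgbin_small // mul0r sub0r opprK.
Qed.

(** * Partial sums and the blocks of a composition *)

Definition psum (t : nat -> nat) (m : nat) : nat := \sum_(i < m) t i.

(** Positive parts give [m <= psum t m], so a bounded search is enough. The value 0 counts, since
    the first letter also opens a block. *)
Definition is_psum (t : nat -> nat) (w : nat) : bool :=
  [exists m : 'I_w.+1, psum t m == w].

Lemma psumS t m : psum t m.+1 = (psum t m + t m)%N.
Proof. exact: big_ord_recr. Qed.

Lemma ltn_psum t m n :
  (forall i, 0 < t i)%N -> (m < n)%N -> (psum t m < psum t n)%N.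
Proof.
move=> t_gt0; elim: n => // n IHn; rewrite ltnS leq_eqVlt psumS => /predU1P[->|].
  by rewrite -addn1 leq_add2l.
by move/IHn/leq_trans; apply; rewrite leq_addr.
Qed.

Lemma leq_psum t m n :
  (forall i, 0 < t i)%N -> (m <= n)%N -> (psum t m <= psum t n)%N.
Proof.
move=> t_gt0; rewrite leq_eqVlt => /predU1P[->//|lt_mn].
exact/ltnW/ltn_psum.
Qed.

Lemma leq_id_psum t m : (forall i, 0 < t i)%N -> (m <= psum t m)%N.
Proof.
move=> t_gt0; elim: m => // m IHm.
by rewrite psumS -addn1 leq_add.
Qed.

Lemma is_psumP t w : (forall i, 0 < t i)%N ->
  reflect (exists m, psum t m = w) (is_psum t w).
Proof.
move=> t_gt0; apply: (iffP existsP) => [[m /eqP <-]|[m <-]]; first by exists m.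
have lt_m : (m < (psum t m).+1)%N by rewrite ltnS leq_id_psum.
by exists (Ordinal lt_m).
Qed.

(** Such a number lies strictly between two consecutive partial sums, and these increase
    strictly. *)
Lemma is_psum_inside t l e : (forall i, 0 < t i)%N ->
  (0 < e < t l)%N -> is_psum t (psum t l + e) = false.
Proof.
move=> t_gt0 /andP[e_gt0 lt_et]; apply/(is_psumP _ t_gt0) => -[m Em].
have [lt_ml|lt_lm|eq_ml] := ltngtP m l.
- by have := ltn_psum t_gt0 lt_ml; rewrite Em ltnNge leq_addr.
- by have := leq_psum t_gt0 lt_lm; rewrite Em psumS leq_add2l leqNgt lt_et.
- by move: Em e_gt0; rewrite eq_ml -[LHS]addn0 => /addnI <-.
Qed.

(** A part [t l] is one opening letter, with factor -1/[k], followed by [t l - 1] repetitions, each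
    with factor x^k/[k]. This yields the summand of [Hq] and one sign per part. *)
Lemma sum_block_psum (K : fieldType) (x : K) t l n : (forall i, 0 < t i)%N ->
  \sum_(k < n.+1) block x (is_psum t) (psum t l) k =
  (-1) ^+ l *
  chain predT (fun i m => x ^+ ((t i - 1) * m) / qint x m ^+ t i) l n.
Proof.
move=> t_gt0; elim: l n => [|l IHl] n.
  rewrite {1}/psum big_ord0 big_ord_recl /= big1 ?addr0 ?mulr1 // => i _.
have repeat e k : (e < t l)%N ->
    block x (is_psum t) (psum t l + e.+1) k =
    (x ^+ k / qint x k) ^+ e *
    (- (\sum_(i < k) block x (is_psum t) (psum t l) i) / qint x k).
  elim: e => [|e IHe] lt_et.
    rewrite addn1 expr0 mul1r /=.
    by rewrite (_ : is_psum t _ = true) //; apply/is_psumP => //; exists l.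
  rewrite addnS [LHS]/= is_psum_inside // IHe; last exact: ltnW.
  by rewrite mulrA -exprS.
have lt_t : ((t l).-1 < t l)%N by rewrite prednK.
rewrite big_ord_recl block_index0 ?add0r; last first.
  by rewrite psumS addn_gt0 t_gt0 orbT.
rewrite [chain _ _ _ _]/= big_add1 /= big_mkord mulr_sumr.
apply: eq_bigr => k _; rewrite /bump leq0n add1n psumS -[X in (_ + X)%N](prednK (t_gt0 l)).
rewrite repeat // IHl -[in RHS](prednK (t_gt0 l)) subn1 /=.
rewrite !expr_div_n -exprM (mulnC _ k.+1) !exprS invfM.
by ring.
Qed.

(** * Integer polynomials as rational functions; coprimality of q-integers *)

Lemma polyfunD f g : polyfun (f + g) = polyfun f + polyfun g.
Proof. by rewrite /polyfun /ratpoly !rmorphD. Qed.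

Lemma polyfunN f : polyfun (- f) = - polyfun f.
Proof. by rewrite /polyfun /ratpoly !rmorphN. Qed.

Lemma polyfunM f g : polyfun (f * g) = polyfun f * polyfun g.
Proof. by rewrite /polyfun /ratpoly !rmorphM. Qed.

Lemma polyfun0 : polyfun 0 = 0.
Proof. by rewrite /polyfun /ratpoly !rmorph0. Qed.

Lemma polyfun1 : polyfun 1 = 1.
Proof. by rewrite /polyfun /ratpoly !rmorph1. Qed.

Lemma ratpolyM f g : ratpoly (f * g) = ratpoly f * ratpoly g.
Proof. by rewrite /ratpoly rmorphM. Qed.

Lemma polyfun_eq0 f : (polyfun f == 0) = (f == 0).
Proof.
rewrite /polyfun tofrac_eq0 /ratpoly -!size_poly_eq0 size_map_inj_poly //.
exact: intr_inj.
Qed.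

Lemma polyfunXn n : polyfun 'X^n = q ^+ n.
Proof. by elim: n => [|n IHn]; rewrite ?polyfun1 // !exprS polyfunM IHn. Qed.

Lemma qnum_qint n : qnum n = qint q n.
Proof.
rewrite /qnum /qnum_poly /qint.
rewrite (big_morph polyfun polyfunD polyfun0).
by apply: eq_bigr => i _; rewrite polyfunXn.
Qed.

Lemma qnum_polyD m n :
  qnum_poly (m + n) = qnum_poly m + 'X^m * qnum_poly n.
Proof.
rewrite /qnum_poly big_split_ord /= mulr_sumr; congr (_ + _).
by apply: eq_bigr => i _; rewrite exprD.
Qed.

Lemma qnum_polyM m n : exists c, qnum_poly (m * n) = c * qnum_poly m.
Proof.
elim: n => [|n [c Ec]]; first by exists 0; rewrite muln0 mul0r /qnum_poly big_ord0.
by exists (1 + 'X^m * c); rewrite mulnS qnum_polyD Ec mulrDl mul1r mulrA.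
Qed.

Lemma qnum_polyS n : qnum_poly n.+1 = 1 + 'X * qnum_poly n.
Proof.
by rewrite -add1n qnum_polyD expr1 /qnum_poly big_ord_recl big_ord0 addr0.
Qed.

Lemma qnum_poly_neq0 n : qnum_poly n.+1 != 0.
Proof.
apply/eqP => /(congr1 (fun f : {poly int} => f`_0)).
by rewrite qnum_polyS coefD coef1 mulrC coefMX coef0.
Qed.

Lemma qint_q_neq0 n : qint q n.+1 != 0.
Proof. by rewrite -qnum_qint polyfun_eq0 qnum_poly_neq0. Qed.

Lemma q_neq0 : q != 0.
Proof. by rewrite polyfun_eq0 polyX_eq0. Qed.

Lemma coprimep_ratpoly (f g a b : {poly int}) :
  a * f + b * g = 1 -> coprimep (ratpoly f) (ratpoly g).
Proof.
move=> E; apply/Bezout_coprimepP; exists (ratpoly a, ratpoly b) => /=.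
by rewrite /ratpoly -!rmorphM -rmorphD E rmorph1 eqpxx.
Qed.

(** The integer Bezout relation lifts: u m = v n + 1 gives [um] = 1 + q [vn], where [m] divides [um]
    and [n] divides [vn]. *)
Lemma coprimep_qnum_poly m n : (0 < m)%N -> coprime m n ->
  coprimep (ratpoly (qnum_poly m)) (ratpoly (qnum_poly n)).
Proof.
move=> m_gt0 co_mn; case: (egcdnP n m_gt0) => u v E _.
rewrite (eqP co_mn) in E.
have [c Ec] := qnum_polyM m u; have [d Ed] := qnum_polyM n v.
apply: (@coprimep_ratpoly _ _ c (- 'X * d)).
by rewrite -Ec mulnC E addn1 qnum_polyS mulnC Ed mulNr mulNr mulrA addrK.
Qed.

Lemma coprimep_X_qnum_poly n : (0 < n)%N ->
  coprimep (ratpoly 'X) (ratpoly (qnum_poly n)).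
Proof.
case: n => // n _; apply: (@coprimep_ratpoly _ _ (- qnum_poly n) 1).
by rewrite qnum_polyS; ring.
Qed.

(** * Congruence modulo [p] as membership in an ideal *)

(* The local ring at [p]_q and its maximal ideal. *)
Definition local (p : nat) (A : ratfun) : Prop :=
  exists f g : {poly int}, A = polyfun f / polyfun g /\
    coprimep (ratpoly g) (ratpoly (qnum_poly p)).

Definition local_ideal (p : nat) (A : ratfun) : Prop :=
  exists2 B, local p B & A = B * qnum p.

Lemma ratpoly_qnum_size p : size (ratpoly (qnum_poly p)) = p.
Proof.
rewrite /ratpoly size_map_inj_poly //; last exact: intr_inj.
rewrite /qnum_poly (_ : \sum_(i < p) 'X^i = \poly_(i < p) 1) //.
  by rewrite size_poly_eq ?oner_eq0.
by rewrite poly_def; apply: eq_bigr => i _; rewrite scale1r.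
Qed.

(** [p] has degree p - 1 > 0, so 0 is not coprime to it. *)
Lemma polyfun_coprime_neq0 p g : (1 < p)%N ->
  coprimep (ratpoly g) (ratpoly (qnum_poly p)) -> polyfun g != 0.
Proof.
move=> p_gt1 co_gp; rewrite polyfun_eq0; apply/eqP => g0.
move: co_gp; rewrite g0 /ratpoly rmorph0 coprime0p -size_poly_eq1.
by rewrite ratpoly_qnum_size eqn_leq leqNgt p_gt1.
Qed.

Lemma local_polyfun p f : local p (polyfun f).
Proof.
exists f, 1; rewrite polyfun1 divr1 /ratpoly rmorph1.
by split; rewrite ?coprime1p.
Qed.

Lemma localV p g : coprimep (ratpoly g) (ratpoly (qnum_poly p)) ->
  local p (polyfun g)^-1.
Proof. by move=> co_gp; exists 1, g; rewrite polyfun1 mul1r. Qed.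

Lemma localM p A B : local p A -> local p B -> local p (A * B).
Proof.
move=> [f [g [-> co_g]]] [f' [g' [-> co_g']]]; exists (f * f'), (g * g').
by rewrite !polyfunM ratpolyM coprimepMl co_g co_g' invfM mulrACA.
Qed.

Lemma localD p A B : (1 < p)%N -> local p A -> local p B -> local p (A + B).
Proof.
move=> p_gt1 [f [g [-> co_g]]] [f' [g' [-> co_g']]].
exists (f * g' + f' * g), (g * g').
rewrite polyfunD !polyfunM ratpolyM coprimepMl co_g co_g' addf_div //.
- exact: polyfun_coprime_neq0 co_g.
- exact: polyfun_coprime_neq0 co_g'.
Qed.

Lemma localN p A : local p A -> local p (- A).
Proof.
by move=> [f [g [-> co_g]]]; exists (- f), g; rewrite polyfunN mulNr.
Qed.

Lemma local0 p : local p 0.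
Proof. by rewrite -polyfun0; apply: local_polyfun. Qed.

Lemma local1 p : local p 1.
Proof. by rewrite -polyfun1; apply: local_polyfun. Qed.

Lemma localX p A n : local p A -> local p (A ^+ n).
Proof.
move=> pA; elim: n => [|n IHn]; first by rewrite expr0; apply: local1.
by rewrite exprS; apply: localM.
Qed.

Lemma local_sum p n (F : 'I_n -> ratfun) : (1 < p)%N ->
  (forall i, local p (F i)) -> local p (\sum_(i < n) F i).
Proof.
move=> p_gt1 pF; apply: big_ind => //; first exact: local0.
by move=> A B; apply: localD.
Qed.

Lemma local_q p : local p q.
Proof. exact: local_polyfun. Qed.

Lemma local_qV p : (0 < p)%N -> local p q^-1.
Proof. by move=> p_gt0; apply/localV/coprimep_X_qnum_poly. Qed.

Lemma local_qintV p k : prime p -> (k < p)%N -> local p (qint q k)^-1.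
Proof.
(* For [k = 0] the inverse of 0 is 0 by convention. *)
move=> pr_p; case: k => [|k] lt_kp; first by rewrite qint0 invr0; apply: local0.
rewrite -qnum_qint; apply/localV/coprimep_qnum_poly => //.
by rewrite coprime_sym prime_coprime // gtnNdvd.
Qed.

Lemma local_ideal0 p : local_ideal p 0.
Proof. by exists 0; [exact: local0 | rewrite mul0r]. Qed.

Lemma local_idealD p A B : (1 < p)%N ->
  local_ideal p A -> local_ideal p B -> local_ideal p (A + B).
Proof.
move=> p_gt1 [A' pA ->] [B' pB ->]; exists (A' + B'); last by rewrite mulrDl.
exact: localD.
Qed.

Lemma local_idealM p A B : local p A -> local_ideal p B -> local_ideal p (A * B).
Proof.
by move=> pA [B' pB ->]; exists (A * B'); [exact: localM | rewrite mulrA].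
Qed.

Lemma local_ideal_eqmod p A B : local_ideal p (A - B) -> eqmod_qnum p A B.
Proof.
move=> [_ [f [g [-> co_g]]] E]; exists (f * qnum_poly p), g; split => //.
  by rewrite E polyfunM mulrAC.
by exists f.
Qed.

Lemma local_block p r w k : prime p -> (k < p)%N -> local p (block q r w k).
Proof.
move=> pr_p; have p_gt1 := prime_gt1 pr_p.
elim: w k => [|w IHw] k lt_kp /=.
  by case: eqP => _; [exact: local1 | exact: local0].
case: (r w); apply: localM.
- apply/localN/local_sum => // i; apply: IHw.
  exact: ltn_trans (ltn_ord i) lt_kp.
- exact: local_qintV.
- by apply: localM; [exact/localX/local_q | exact: local_qintV].
- exact: IHw.
Qed.

Lemma local_sgbin p n k : (1 < p)%N -> local p (sgbin q n k).
Proof.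
move=> p_gt1; elim: n k => [|n IHn] [|k] /=;
  try exact: local1; first exact: local0.
apply: localM; first exact/localX/local_q.
by apply: localD => //; apply: localN.
Qed.

(** Induction from b_(p-1)(0) = 1: by [sgbin_step] with n + 1 = p, consecutive values differ by a
    local multiple of [p]. *)
Lemma sgbin_pred_prime p k : prime p -> (k < p)%N ->
  local_ideal p (sgbin q p.-1 k - 1).
Proof.
move=> pr_p; have p_gt1 := prime_gt1 pr_p; have p_gt0 := prime_gt0 pr_p.
elim: k => [|k IHk] lt_kp.
  by rewrite sgbin_n0 subrr; apply: local_ideal0.
rewrite -(subrK (sgbin q p.-1 k) (sgbin q p.-1 k.+1)) -addrA.
apply: local_idealD => //; last exact/IHk/ltnW.
have step := sgbin_step p.-1 q_neq0 (qint_q_neq0 k).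
rewrite (prednK p_gt0) -(qnum_qint p) in step.
exists (q ^- p / qint q k.+1 * (sgbin q p k.+1 - sgbin q p.-1 k.+1));
  last exact: step.
apply: localM; last first.
  by apply: localD => //; [exact: local_sgbin | exact/localN/local_sgbin].
apply: localM; last exact: local_qintV.
by rewrite -exprVn; apply/localX/local_qV.
Qed.

(** * The sums of the statement as chains, and the conclusion *)

Definition extend1 (l : nat) (s : 'I_l -> nat) (i : nat) : nat :=
  oapp s 1%N (insub i).

Lemma extend1E l (s : 'I_l -> nat) (i : 'I_l) : extend1 s i = s i.
Proof. by rewrite /extend1 valK. Qed.

(** The padding value 1 keeps the extended sequence positive everywhere, as the lemmas on partial
    sums require. *)
Lemma extend1_gt0 l (s : 'I_l -> nat) i :
  (forall i, 0 < s i)%N -> (0 < extend1 s i)%N.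
Proof. by move=> s_gt0; rewrite /extend1; case: insubP => [j _ _|_] /=. Qed.

Lemma psum_extend1 l (s : 'I_l -> nat) m : (m <= l)%N ->
  psum (extend1 s) m = (\sum_(i < l | (i < m)%N) s i)%N.
Proof.
move=> le_ml; rewrite /psum (big_ord_widen _ _ le_ml).
by apply: eq_bigr => i _; rewrite extend1E.
Qed.

Lemma sum_extend1 l (s : 'I_l -> nat) :
  psum (extend1 s) l = (\sum_(i < l) s i)%N.
Proof. by apply: eq_bigr => i _; rewrite extend1E. Qed.

(** [psums] leaves out the partial sum 0 and the total, hence the strict range of [b]. *)
Lemma mem_psums l (s : 'I_l -> nat) b : (forall i, 0 < s i)%N ->
  (0 < b < \sum_(i < l) s i)%N -> (b \in psums s) = is_psum (extend1 s) b.
Proof.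
move=> s_gt0; have t_gt0 i := extend1_gt0 i s_gt0.
rewrite -sum_extend1 => /andP[b_gt0 lt_b].
apply/mapP/(is_psumP _ t_gt0) => [[m]|[m Em]].
  rewrite mem_iota => /andP[m_gt0 lt_m] ->; exists m; apply: psum_extend1.
  by case: (l) lt_m => [|l'] /=; lia.
have lt_ml : (m < l)%N.
  rewrite ltnNge; apply: contraL lt_b => le_lm; rewrite -leqNgt -Em.
  exact: leq_psum.
exists m; last by rewrite -Em psum_extend1 // ltnW.
have m_gt0 : (0 < m)%N.
  by case: m Em {lt_ml} b_gt0 => // <-; rewrite /psum big_ord0.
rewrite mem_iota m_gt0 /=; lia.
Qed.

(** [Hq] orders all pairs of indices, [chain] only neighbours; transitivity closes the gap. *)
Lemma Hq_chain n l (s : 'I_l -> nat) :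
  Hq n s = chain predT (fun i m => q ^+ ((extend1 s i - 1) * m) /
                                   qint q m ^+ extend1 s i) l n.
Proof.
rewrite -(sum_chain_cond _ _ _ (leqnn n)); apply: eq_big => [k|k _]; last first.
  by apply: eq_bigr => i _; rewrite extend1E qnum_qint.
apply/andP/and3P => [[pos /forallP ord]|[pos /forallP ord _]]; split => //.
- apply/forallP => a; apply/forallP => b; apply/implyP => /eqP ba /=.
  by have /forallP/(_ b)/implyP := ord a; apply; rewrite ba.
- by apply/forallP => a; rewrite -ltnS ltn_ord implybT.
- apply/forallP => a; apply/forallP => -[b lt_bl]; apply/implyP => /=.
  elim: b lt_bl => // b IHb lt_bl; rewrite ltnS leq_eqVlt.
  have /forallP/(_ (Ordinal lt_bl))/implyP /= step := ord (Ordinal (ltnW lt_bl)).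
  case/predU1P => [ab|/IHb lt_ab].
    by have -> : a = Ordinal (ltnW lt_bl) by [apply: val_inj]; apply: step.
  exact: ltn_trans (lt_ab _) (step (eqxx _)).
Qed.

Lemma Sq_chain n l (s : 'I_l -> nat) : (forall i, 0 < s i)%N ->
  Sq n (\sum_(i < l) s i) (psums s) =
  chain (is_psum (extend1 s)) (fun _ m => q ^+ m / qint q m)
    (\sum_(i < l) s i) n.
Proof.
move=> s_gt0; rewrite -(sum_chain_cond _ _ _ (leqnn n)).
apply: eq_big => [j|j _]; last by apply: eq_bigr => i _; rewrite qnum_qint.
rewrite /chain_cond; congr (_ && _).
rewrite [X in _ && X](_ : _ = true) ?andbT; last first.
  by apply/forallP => a; rewrite -ltnS ltn_ord implybT.
apply: eq_forallb => a; apply: eq_forallb => b; case: eqP => //= ba.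
by rewrite -ba mem_psums // ltn_ord ba.
Qed.

Theorem theorem8p2 (p l : nat) (s : 'I_l -> nat)
    (pr_p : prime p) (l_ge1 : (1 <= l)%N) (s_gt0 : forall i : 'I_l, (0 < s i)%N) :
  eqmod_qnum p
    (Hq p.-1 s)
    ((-1) ^+ l * Sq p.-1 (\sum_(i < l) s i)%N (psums s)).
Proof.
have p_gt1 := prime_gt1 pr_p; apply: local_ideal_eqmod.
have t_gt0 i := extend1_gt0 i s_gt0.
have r0 : is_psum (extend1 s) 0.
  by apply/is_psumP => //; exists 0; rewrite /psum big_ord0.
rewrite Sq_chain // -sum_extend1 -(sum_sgbin_block _ _ q_neq0 qint_q_neq0 r0).
(* Inserting the sign twice lets [sum_block_psum] apply: both sides become (-1)^l times a sum of the
   same blocks, with weights 1 and b_(p-1)(k). *)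
rewrite -[Hq _ _](signrMK l) Hq_chain -sum_block_psum // -mulrBr -sumrB.
apply: local_idealM; first exact/localX/localN/local1.
apply: big_ind => [||k _]; first exact: local_ideal0.
  by move=> A B; apply: local_idealD.
have lt_kp : (k < p)%N.
  by apply: leq_trans (ltn_ord k) _; rewrite prednK // prime_gt0.
rewrite -[X in X - _]mul1r -mulrBl -opprB mulNr -mulrN mulrC.
apply: local_idealM; last exact: sgbin_pred_prime.
exact/localN/local_block.
Qed.
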